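(* Let $\omega\mapsto\gamma(f(\omega))$ be a continuous, strictly positive and monotone increasing function on $[0,\infty)$. Let the (finite) limit $$\lim_{\omega\to\infty}\int_0^{\omega}\frac{d\sigma}{\gamma(f(\sigma))}=T^+$$ exist. Then the Cauchy problem $$\frac{d\omega}{dt}=\gamma(f(\omega(t))),\qquad \omega(0)=0,$$ has a monotone increasing solution $\omega^+(t)$ in the cone $C^+_{[0,T^+)}$. The approximations $$\omega_n(t)=\int_0^t\gamma(f(\omega_{n-1}(s)))\,ds,\qquad \omega_0=0,$$ converge to $\omega^+(t)$ for $t\in[0,T^+)$, and $\lim_{t\to T^+}\omega^+(t)=\infty$.
   Context: $f$ and $\gamma$ are real-valued monotone increasing continuous functions of a real variable whose superposition $\gamma(f(\omega))$ is defined for $\omega\ge0$. $C^+_{[0,T^+)}$ is the cone of continuous nonnegative real functions on $[0,T^+)$. *)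

(* Defs.v *)
From HB Require Import structures.
From mathcomp Require Import all_boot all_order all_algebra.
From mathcomp Require Import all_classical all_reals all_analysis.
Set Implicit Arguments.
Unset Strict Implicit.
Unset Printing Implicit Defensive.
Import Order.TTheory GRing.Theory Num.Theory.
Import numFieldNormedType.Exports.
Local Open Scope classical_set_scope.
Local Open Scope ring_scope.

(* The cone of continuous nonnegative functions on [0, T[; the functions are
   total and their values off [0, T[ are irrelevant. *)
Definition Cplus {R : realType} (T : R) : set (R -> R) :=
  [set u : R -> R | {within `[0, T[, continuous u}
                    /\ forall t : R, t \in `[0, T[ -> 0 <= u t].

(* [u] has derivative [l] at [t] relative to [D]: two-sided at interior points
   of [D], one-sided at an endpoint belonging to [D]. *)
Definition is_deriv_within {R : realType} (D : set R) (u : R -> R) (t l : R) :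
    Prop :=
  (u s - u t) / (s - t) @[s --> within D t^'] --> l.

Definition solves_cauchy {R : realType} (F : R -> R) (u0 T : R) (u : R -> R) :
    Prop :=
  u 0 = u0 /\
  forall t : R, t \in `[0, T[ -> is_deriv_within `[0, T[ u t (F (u t)).

Fixpoint picard {R : realType} (F : R -> R) (n : nat) : R -> R :=
  match n with
  | 0%N => fun=> 0
  | m.+1 => fun t => \int[lebesgue_measure]_(s in `[0, t]) F (picard F m s)
  end.

(* Main.v *)
Require Import Defs.
From HB Require Import structures.
From mathcomp Require Import all_boot all_order all_algebra.
From mathcomp Require Import all_classical all_reals all_analysis.
From mathcomp Require Import ring lra.
Import Order.TTheory GRing.Theory Num.Theory.
Import numFieldNormedType.Exports.
Local Open Scope classical_set_scope.
Local Open Scope ring_scope.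

(* Write F for gamma o f and G w for the integral of 1/F over [0, w], the time
   needed to reach w.  Since F is nondecreasing, the Picard iterates satisfy
   F (p_n s) (t - s) <= p_(n+1) t - p_(n+1) s <= F (p_n t) (t - s) for s <= t
   and increase with n.  Dividing such increments by F and summing over finer
   and finer partitions gives G (p_n t) <= t < T = sup G, so the iterates stay
   bounded on [0, T[.  Their limit u inherits
   F (u s) (t - s) <= u t - u s <= F (u t) (t - s), whence u is strictly
   increasing, continuous and solves u' = F u; the lower half also gives
   t <= G (u t), which forces u to blow up at T. *)

(** * Increment estimates and integrals of monotone functions *)

(* Over [n] equal pieces the increments of [h] telescope, so
   [E t - E 0 <= t / n * (h t - h 0)] for every [n]; no continuity is needed. *)
Lemma le_of_increment_le (R : realType) (E h : R -> R) (t : R) : 0 <= t ->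
  (forall a b, 0 <= a -> a <= b -> b <= t ->
    E b - E a <= (b - a) * (h b - h a)) ->
  E t <= E 0.
Proof.
move=> t0 Eh; have [//|lt0] := leP (E t) (E 0).
pose d := E t - E 0; have d0 : 0 < d by rewrite subr_gt0.
pose c := t * (h t - h 0).
(* This choice gives [c < n * d], against the bound [d <= c / n] obtained by telescoping. *)
pose n := (Num.truncn (c / d)).+1.
have n0 : 0 < n%:R :> R by rewrite ltr0n.
have cn : c < n%:R * d by rewrite -ltr_pdivrMr// truncnS_gt.
pose x (k : nat) := k%:R * (t / n%:R).
have xS k : x k.+1 - x k = t / n%:R by rewrite /x -mulrBl -natrB// subSnn mul1r.
have x0 k : 0 <= x k by rewrite mulr_ge0// divr_ge0// ltW.
have xn : x n = t by rewrite /x mulrCA divff ?mulr1// gt_eqF.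
have x00 : x 0%N = 0 by rewrite /x mul0r.
suff : d <= t / n%:R * (h t - h 0).
  by rewrite mulrAC ler_pdivlMr// mulrC => /(lt_le_trans cn); rewrite ltxx.
rewrite /d -xn -x00 -(telescope_sumr (E \o x) (leq0n n)).
rewrite -(telescope_sumr (h \o x) (leq0n n)) mulr_sumr.
apply: ler_sum_nat => k /andP[_ kn] /=.
have tn0 : 0 <= t / n%:R by rewrite divr_ge0// ltW.
rewrite xn -(xS k); apply: Eh => //; first by rewrite -subr_ge0 xS.
by rewrite -xn /x ler_wpM2r// ler_nat.
Qed.

Lemma integrable_homo_itv0 (R : realType) (g : R -> R) (t : R) :
  (forall a b, 0 <= a -> a <= b -> g a <= g b) ->
  (@lebesgue_measure R).-integrable `[0, t] (EFin \o g).
Proof.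
move=> g_nd; apply: measurable_bounded_integrable => //.
- rewrite /= lebesgue_measure_itv/=; case: ifP => _ //.
  by rewrite -EFinB ltry.
(* Monotonicity is known only on [[0, +oo[]; precomposing with [Num.max 0] yields a function that is
   monotone on the whole line and agrees with [g] on [[0, t]]. *)
- apply: (eq_measurable_fun (fun s : R => g (Num.max 0 s))).
    by move=> s; rewrite inE/= in_itv/= => /andP[s0 _]; rewrite max_r.
  apply: measurable_realfun.nondecreasing_measurable => // a b ab.
  apply: g_nd; first by rewrite le_max lexx.
  by rewrite ge_max !le_max lexx ab orbT.
- exists (`|g 0| + `|g t|); split; first exact: num_real.
  move=> M gM s /=; rewrite in_itv/= => /andP[s0 st]; apply: le_trans (ltW gM).
  have := g_nd _ _ (lexx 0) s0; have := g_nd _ _ s0 st.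
  move=> /= h1 h2; rewrite ler_norml; apply/andP; split.
    have := ler_norm (- g 0); rewrite normrN.
    by have := normr_ge0 (g t); lra.
  by have := ler_norm (g t); have := normr_ge0 (g 0); lra.
Qed.

(** The difference is the integral over []s, t]], compared there with two constants. Leaving [m] and
    [M] free lets it serve both nondecreasing integrands and the nonincreasing [1 / F]. *)
Lemma Rintegral_increment_bounds (R : realType) (g : R -> R) (m M s t : R) :
  (@lebesgue_measure R).-integrable `[0, t] (EFin \o g) ->
  0 <= s -> s <= t ->
  (forall x, s <= x -> x <= t -> m <= g x <= M) ->
  m * (t - s) <= \int[lebesgue_measure]_(x in `[0, t]) g x -
                 \int[lebesgue_measure]_(x in `[0, s]) g x <= M * (t - s).
Proof.
move=> ig s0 st gmM.
rewrite Rintegral_itvB ?bnd_simp//.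
have sub : `]s, t] `<=` `[0, t].
  by move=> x/=; rewrite !in_itv/= => /andP[/ltW/(le_trans s0)-> ->].
have ig' : lebesgue_measure.-integrable `]s, t] (EFin \o g).
  exact: integrableS ig.
have fin : (lebesgue_measure (`]s, t] : set R) < +oo)%E.
  by rewrite lebesgue_measure_itv/=; case: ifP => _ //; rewrite -EFinB ltry.
have len : fine (lebesgue_measure (`]s, t] : set R)) = t - s.
  rewrite lebesgue_measure_itv/= lte_fin; case: ltP => //= ts.
  by apply/esym/eqP; rewrite subr_eq0 eq_le ts st.
have icst (c : R) : lebesgue_measure.-integrable `]s, t] (EFin \o (fun=> c)).
  apply: measurable_bounded_integrable => //.
  by exists `|c|; split => // x /ltW cx y _.
rewrite -len -!Rintegral_cst//; apply/andP; split; apply: le_Rintegral => //.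
- by move=> x /=; rewrite in_itv/= => /andP[/ltW sx /(gmM _ sx)/andP[]].
- by move=> x /=; rewrite in_itv/= => /andP[/ltW sx /(gmM _ sx)/andP[]].
Qed.

Lemma homo_Rintegral_bounds (R : realType) (g : R -> R) (s t : R) :
  (forall a b, 0 <= a -> a <= b -> g a <= g b) -> 0 <= s -> s <= t ->
  g s * (t - s) <= \int[lebesgue_measure]_(x in `[0, t]) g x -
                   \int[lebesgue_measure]_(x in `[0, s]) g x <= g t * (t - s).
Proof.
move=> g_nd s0 st; apply: Rintegral_increment_bounds => //.
  exact: integrable_homo_itv0.
by move=> x sx xt; rewrite !g_nd// (le_trans s0).
Qed.

(** * The travel time and its comparison with elapsed time *)

Definition travel_time {R : realType} (F : R -> R) (w : R) : R :=
  \int[lebesgue_measure]_(s in `[0, w]) (F s)^-1.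

Lemma travel_time0 (R : realType) (F : R -> R) : travel_time F 0 = 0.
Proof. by rewrite /travel_time set_itv1 Rintegral_set1. Qed.

Lemma travel_time_bounds (R : realType) (F : R -> R) (v w : R) :
  (forall x, 0 <= x -> 0 < F x) ->
  (forall x y, 0 <= x -> x <= y -> F x <= F y) ->
  0 <= v -> v <= w ->
  (w - v) / F w <= travel_time F w - travel_time F v <= (w - v) / F v.
Proof.
move=> F_pos F_nd v0 vw; rewrite ![(w - v) / _]mulrC.
apply: Rintegral_increment_bounds => //; last first.
  move=> x vx xw; have x0 := le_trans v0 vx.
  by rewrite !lef_pV2 ?posrE ?F_pos ?F_nd// (le_trans v0).
(* [1 / F] is nonincreasing, so integrability is obtained for its opposite, which is nondecreasing,
   and the sign is then undone. *)
have : (@lebesgue_measure R).-integrable `[0, w]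
         (EFin \o (fun x => - (F x)^-1)).
  apply: integrable_homo_itv0 => a b a0 ab.
  by rewrite lerN2 lef_pV2 ?posrE ?F_pos ?F_nd// (le_trans a0).
move=> /integrableN; apply: eq_integrable => // x _ /=.
by rewrite opprK.
Qed.

(** Since [1 / F <= 1 / F (v a)] between [v a] and [v b], the excess [E] of travel time over elapsed
    time grows on [[a, b]] by at most [(F (v b) - F (v a)) (b - a) / F (v a)]. Telescoping over fine
    partitions makes such errors vanish. *)
Lemma travel_time_le (R : realType) (F v : R -> R) (t : R) :
  (forall x, 0 <= x -> 0 < F x) ->
  (forall x y, 0 <= x -> x <= y -> F x <= F y) ->
  0 <= t -> v 0 = 0 ->
  (forall a b, 0 <= a -> a <= b -> b <= t -> v a <= v b) ->
  (forall a b, 0 <= a -> a <= b -> b <= t -> v b - v a <= F (v b) * (b - a)) ->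
  travel_time F (v t) <= t.
Proof.
move=> F_pos F_nd t0 v0 v_nd vF.
pose E x := travel_time F (v x) - x.
suff : E t <= E 0 by rewrite /E v0 travel_time0 subr0 subr_le0.
apply: (@le_of_increment_le _ _ (fun x => F (v x) / F 0)) => // a b a0 ab bt.
have va0 : 0 <= v a by rewrite -v0 v_nd// (le_trans ab).
have vab := v_nd _ _ a0 ab bt.
have /andP[_ Gle] := travel_time_bounds _ _ _ _ F_pos F_nd va0 vab.
have FFab := F_nd _ _ va0 vab.
have Fa0 : 0 < F (v a) := F_pos _ va0.
have F00 : 0 < F 0 := F_pos _ (lexx 0).
have /(le_trans Gle) H : (v b - v a) / F (v a) <= F (v b) * (b - a) / F (v a).
  by rewrite ler_pM2r ?invr_gt0// vF.
(* Lowering the denominator to the fixed [F 0] turns the error into [b - a] times an increment of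
   the single function [F (v x) / F 0]. *)
have K : (F (v b) - F (v a)) * (b - a) / F (v a)
         <= (F (v b) - F (v a)) * (b - a) / F 0.
  apply: ler_wpM2l; first by rewrite mulr_ge0// subr_ge0.
  by rewrite lef_pV2 ?posrE// F_nd.
have -> : (b - a) * (F (v b) / F 0 - F (v a) / F 0)
          = (F (v b) - F (v a)) * (b - a) / F 0 by ring.
apply: le_trans K; rewrite mulrBl mulrBl [F (v a) * _]mulrC mulfK ?gt_eqF//.
by rewrite /E; lra.
Qed.

(** The mirror argument: [1 / F >= 1 / F (v b)] between [v a] and [v b], so the error now carries
    the denominator [F (v b)]. Applied to the limit of the iterates, it forces blow-up. *)
Lemma travel_time_ge (R : realType) (F v : R -> R) (t : R) :
  (forall x, 0 <= x -> 0 < F x) ->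
  (forall x y, 0 <= x -> x <= y -> F x <= F y) ->
  0 <= t -> v 0 = 0 ->
  (forall a b, 0 <= a -> a <= b -> b <= t -> v a <= v b) ->
  (forall a b, 0 <= a -> a <= b -> b <= t -> F (v a) * (b - a) <= v b - v a) ->
  t <= travel_time F (v t).
Proof.
move=> F_pos F_nd t0 v0 v_nd vF.
pose E x := x - travel_time F (v x).
suff : E t <= E 0 by rewrite /E v0 travel_time0 subr0 subr_le0.
apply: (@le_of_increment_le _ _ (fun x => F (v x) / F 0)) => // a b a0 ab bt.
have va0 : 0 <= v a by rewrite -v0 v_nd// (le_trans ab).
have vab := v_nd _ _ a0 ab bt.
have vb0 := le_trans va0 vab.
have /andP[Gge _] := travel_time_bounds _ _ _ _ F_pos F_nd va0 vab.
have FFab := F_nd _ _ va0 vab.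
have Fb0 : 0 < F (v b) := F_pos _ vb0.
have F00 : 0 < F 0 := F_pos _ (lexx 0).
have H : F (v a) * (b - a) / F (v b) <= (v b - v a) / F (v b).
  by rewrite ler_pM2r ?invr_gt0// vF.
have K : (F (v b) - F (v a)) * (b - a) / F (v b)
         <= (F (v b) - F (v a)) * (b - a) / F 0.
  apply: ler_wpM2l; first by rewrite mulr_ge0// subr_ge0.
  by rewrite lef_pV2 ?posrE// F_nd.
have -> : (b - a) * (F (v b) / F 0 - F (v a) / F 0)
          = (F (v b) - F (v a)) * (b - a) / F 0 by ring.
apply: le_trans K; rewrite mulrBl mulrBl [F (v b) * _]mulrC mulfK ?gt_eqF//.
by rewrite /E; lra.
Qed.

(** * Monotonicity and growth of the Picard iterates *)

(** The two claims share one induction: [F] is controlled only on [[0, +oo[], so the monotonicity of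
    [F \o picard F n] relies on the iterate being nonnegative. *)
Lemma picard_ge0_homo (R : realType) (F : R -> R) (n : nat) :
  (forall x, 0 <= x -> 0 < F x) ->
  (forall x y, 0 <= x -> x <= y -> F x <= F y) ->
  (forall t, 0 <= t -> 0 <= picard F n t) /\
  (forall s t, 0 <= s -> s <= t -> picard F n s <= picard F n t).
Proof.
move=> F_pos F_nd; elim: n => [//|n [p_ge0 p_nd]].
have ge0 t : 0 <= t -> 0 <= picard F n.+1 t.
  move=> t0; apply: Rintegral_ge0 => s /=; rewrite in_itv/= => /andP[s0 _].
  by apply/ltW/F_pos/p_ge0.
split=> // s t s0 st; rewrite -subr_ge0.
have /andP[+ _] := @homo_Rintegral_bounds _ (F \o picard F n) s t
  (fun a b a0 ab => F_nd _ _ (p_ge0 _ a0) (p_nd _ _ a0 ab)) s0 st.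
by apply: le_trans; rewrite mulr_ge0 ?subr_ge0//; exact/ltW/F_pos/p_ge0.
Qed.

(** The integrand [F \o picard F n] is nondecreasing, so its extreme values sit at the endpoints.
    Passing to the limit in this bound later replaces a limit under the integral sign. *)
Lemma picardS_bounds (R : realType) (F : R -> R) (n : nat) (s t : R) :
  (forall x, 0 <= x -> 0 < F x) ->
  (forall x y, 0 <= x -> x <= y -> F x <= F y) ->
  0 <= s -> s <= t ->
  F (picard F n s) * (t - s) <= picard F n.+1 t - picard F n.+1 s
                             <= F (picard F n t) * (t - s).
Proof.
move=> F_pos F_nd s0 st; have [p_ge0 p_nd] := picard_ge0_homo _ _ n F_pos F_nd.
apply: (@homo_Rintegral_bounds _ (F \o picard F n)) => // a b a0 ab.
by rewrite F_nd ?p_ge0 ?p_nd.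
Qed.

Lemma picard_at0 (R : realType) (F : R -> R) (n : nat) : picard F n 0 = 0.
Proof. by case: n => //= n; rewrite set_itv1 Rintegral_set1. Qed.

(** Induction on [n], for all [t] at once: [F] and the integral both preserve order, and the zero
    iterate lies below the first. *)
Lemma picard_leS (R : realType) (F : R -> R) (n : nat) (t : R) :
  (forall x, 0 <= x -> 0 < F x) ->
  (forall x y, 0 <= x -> x <= y -> F x <= F y) ->
  0 <= t -> picard F n t <= picard F n.+1 t.
Proof.
move=> F_pos F_nd; elim: n t => [t t0|n IHn t t0].
  by have [+ _] := picard_ge0_homo _ _ 1 F_pos F_nd; apply.
have iF k : (@lebesgue_measure R).-integrable `[0, t]
    (EFin \o (F \o picard F k)).
  have [p_ge0 p_nd] := picard_ge0_homo _ _ k F_pos F_nd.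
  by apply: integrable_homo_itv0 => a b a0 ab; rewrite /= F_nd ?p_ge0 ?p_nd.
apply: le_Rintegral => //; [exact: (iF n)|exact: (iF n.+1)|].
move=> x /=; rewrite in_itv/= => /andP[x0 _].
have [p_ge0 _] := picard_ge0_homo _ _ n F_pos F_nd.
by rewrite F_nd ?p_ge0 ?IHn.
Qed.

(** The iterate [n.+1] has slope at most [F (picard F n b)], hence at most [F (picard F n.+1 b)]
    because the iterates increase with [n]; this makes it a subsolution. *)
Lemma travel_time_picard_le (R : realType) (F : R -> R) (n : nat) (t : R) :
  (forall x, 0 <= x -> 0 < F x) ->
  (forall x y, 0 <= x -> x <= y -> F x <= F y) ->
  0 <= t -> travel_time F (picard F n t) <= t.
Proof.
move=> F_pos F_nd t0; case: n => [|n]; first by rewrite travel_time0.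
have [p_ge0 p_nd] := picard_ge0_homo _ _ n F_pos F_nd.
have [_ pS_nd] := picard_ge0_homo _ _ n.+1 F_pos F_nd.
apply: travel_time_le => //; first exact: picard_at0.
  by move=> a b a0 ab _; exact: pS_nd.
move=> a b a0 ab _; have b0 := le_trans a0 ab.
have /andP[_ /le_trans] := picardS_bounds _ _ n _ _ F_pos F_nd a0 ab.
apply; apply: ler_wpM2r; first by rewrite subr_ge0.
by rewrite F_nd ?p_ge0 ?picard_leS.
Qed.

(** * Boundedness and convergence of the iterates before time [T] *)

Lemma travel_time_lt (R : realType) (F : R -> R) (v w : R) :
  (forall x, 0 <= x -> 0 < F x) ->
  (forall x y, 0 <= x -> x <= y -> F x <= F y) ->
  0 <= v -> v < w -> travel_time F v < travel_time F w.
Proof.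
move=> F_pos F_nd v0 vw.
have /andP[+ _] := travel_time_bounds _ _ _ _ F_pos F_nd v0 (ltW vw).
rewrite -subr_gt0; apply: lt_le_trans.
by rewrite divr_gt0 ?subr_gt0// F_pos// (le_trans v0 (ltW vw)).
Qed.

Lemma travel_time_lt_lim (R : realType) (F : R -> R) (T w : R) :
  (forall x, 0 <= x -> 0 < F x) ->
  (forall x y, 0 <= x -> x <= y -> F x <= F y) ->
  travel_time F x @[x --> +oo] --> T -> 0 <= w -> travel_time F w < T.
Proof.
move=> F_pos F_nd GT w0; have w1 : 0 <= w + 1 by rewrite addr_ge0.
(* Limits preserve only weak inequalities, so strictness is gained between [w] and [w + 1]. *)
apply: (@lt_le_trans _ _ (travel_time F (w + 1))).
  by apply: travel_time_lt => //; rewrite ltrDl.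
apply: (cvgr_to_ge GT); apply: filterS (nbhs_pinfty_gt (num_real (w + 1))).
by move=> x wx; apply/ltW/travel_time_lt.
Qed.

Lemma picard_cvg (R : realType) (F : R -> R) (T t : R) :
  (forall x, 0 <= x -> 0 < F x) ->
  (forall x y, 0 <= x -> x <= y -> F x <= F y) ->
  travel_time F x @[x --> +oo] --> T -> 0 <= t -> t < T ->
  nondecreasing_seq (fun n => picard F n t) /\ cvgn (fun n => picard F n t).
Proof.
move=> F_pos F_nd GT t0 tT.
have nd : nondecreasing_seq (fun n => picard F n t).
  by apply/nondecreasing_seqP => n; exact: picard_leS.
split=> //; apply: nondecreasing_is_cvgn => //.
(* This [w] bounds every iterate at [t]: an iterate beyond [w] would have travel time greater than
   [t]. *)
have [w [w0 tw]] : exists w, 0 <= w /\ t < travel_time F w.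
  have : \forall w \near +oo, 0 <= w /\ t < travel_time F w.
    apply: filterI; first exact: nbhs_pinfty_ge (num_real 0).
    exact: (cvgr_gt _ GT).
  by move=> /filter_ex.
exists w => _ [n _ <-]; rewrite leNgt; apply/negP => wp.
have := travel_time_picard_le _ _ n _ F_pos F_nd t0.
by rewrite leNgt (lt_trans tw)// travel_time_lt.
Qed.

(** * The limit of the iterates: increments, continuity, derivative *)

Definition picard_lim {R : realType} (F : R -> R) (t : R) : R :=
  lim (picard F n t @[n --> \oo]).

Lemma picard_lim_ge0 (R : realType) (F : R -> R) (T t : R) :
  (forall x, 0 <= x -> 0 < F x) ->
  (forall x y, 0 <= x -> x <= y -> F x <= F y) ->
  travel_time F x @[x --> +oo] --> T -> 0 <= t -> t < T ->
  0 <= picard_lim F t.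
Proof.
move=> F_pos F_nd GT t0 tT.
have [nd cv] := picard_cvg _ _ _ _ F_pos F_nd GT t0 tT.
(* The iterate of index 0 is the zero function, and the limit dominates it. *)
exact: (nondecreasing_cvgn_le nd cv 0%N).
Qed.

Lemma picard_lim_bounds (R : realType) (F : R -> R) (T s t : R) :
  {within `[0, +oo[, continuous F} ->
  (forall x, 0 <= x -> 0 < F x) ->
  (forall x y, 0 <= x -> x <= y -> F x <= F y) ->
  travel_time F x @[x --> +oo] --> T ->
  0 <= s -> s <= t -> t < T ->
  F (picard_lim F s) * (t - s) <= picard_lim F t - picard_lim F s
                               <= F (picard_lim F t) * (t - s).
Proof.
move=> F_cont F_pos F_nd GT s0 st tT.
have t0 := le_trans s0 st; have sT := le_lt_trans st tT.
have [nds cvs] := picard_cvg _ _ _ _ F_pos F_nd GT s0 sT.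
have [ndt cvt] := picard_cvg _ _ _ _ F_pos F_nd GT t0 tT.
have dcvg : picard F n.+1 t - picard F n.+1 s @[n --> \oo]
            --> picard_lim F t - picard_lim F s.
  by apply: cvgB; rewrite (cvg_shiftS (fun n => picard F n _)).
apply/andP; split; last first.
  (* Upper half: monotonicity suffices, since [picard F n t] stays below its limit. *)
  apply: (cvgr_to_le dcvg); apply: nearW => n.
  have /andP[_ /le_trans] := picardS_bounds _ _ n _ _ F_pos F_nd s0 st; apply.
  rewrite ler_wpM2r ?subr_ge0//.
  have [p_ge0 _] := picard_ge0_homo _ _ n F_pos F_nd.
  by rewrite F_nd ?p_ge0//; exact: nondecreasing_cvgn_le.
(* Lower half: [F (picard F n s)] approaches its limit from below, so continuity of [F] is used,
   relative to [[0, +oo[] where the iterates live. *)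
have Fcvg : F (picard F n s) @[n --> \oo] --> F (picard_lim F s).
  have := (subspace_continuousP _ _).1 F_cont (picard_lim F s).
  rewrite /= in_itv/= andbT => /(_ (picard_lim_ge0 _ _ _ _ F_pos F_nd GT s0 sT)).
  apply: cvg_trans => U /=; rewrite /within/= => FU.
  have H : \forall n \near \oo, `[0, +oo[%classic (picard F n s) ->
    U (F (picard F n s)) := cvs _ FU.
  apply: filterS H => n; apply.
  rewrite /= in_itv/= andbT.
  by have [p_ge0 _] := picard_ge0_homo _ _ n F_pos F_nd; exact: p_ge0.
have Fcvg' : F (picard F n s) * (t - s) @[n --> \oo]
             --> F (picard_lim F s) * (t - s) by exact: cvgM Fcvg (cvg_cst _).
apply: (ler_cvg_to Fcvg' dcvg); apply: nearW => n.
by have /andP[] := picardS_bounds _ _ n _ _ F_pos F_nd s0 st.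
Qed.

Lemma picard_lim_cvg (R : realType) (F : R -> R) (T t : R) :
  {within `[0, +oo[, continuous F} ->
  (forall x, 0 <= x -> 0 < F x) ->
  (forall x y, 0 <= x -> x <= y -> F x <= F y) ->
  travel_time F x @[x --> +oo] --> T -> 0 <= t -> t < T ->
  picard_lim F s @[s --> within `[0, T[ (nbhs t)] --> picard_lim F t.
Proof.
move=> F_cont F_pos F_nd GT t0 tT.
have bnd := fun a b => picard_lim_bounds _ _ _ a b F_cont F_pos F_nd GT.
have u_ge0 := fun a => picard_lim_ge0 _ _ _ a F_pos F_nd GT.
(* A point [r] strictly between [t] and [T] leaves room to the right of [t]; on [[0, r]] the limit
   is Lipschitz with constant [F (picard_lim F r)]. *)
have [r [tr rT]] : exists r, t < r /\ r < T.
  by exists ((t + T) / 2); rewrite midf_lt// midf_lt.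
have r0 : 0 <= r by rewrite (le_trans t0)// ltW.
have K0 : 0 < F (picard_lim F r) by rewrite F_pos// u_ge0.
have lip a b : 0 <= a -> a <= b -> b <= r ->
    `|picard_lim F b - picard_lim F a| <= F (picard_lim F r) * (b - a).
  move=> a0 ab br; have b0 := le_trans a0 ab; have bT := le_lt_trans br rT.
  have aT := le_lt_trans ab bT.
  have /andP[lo hi] := bnd _ _ a0 ab bT.
  have /andP[lo' _] := bnd _ _ b0 br rT.
  rewrite ger0_norm; last first.
    by rewrite (le_trans _ lo)// mulr_ge0 ?subr_ge0// ltW// F_pos// u_ge0.
  apply: le_trans hi _; rewrite ler_wpM2r ?subr_ge0//.
  apply: F_nd; first exact: u_ge0.
  rewrite -subr_ge0 (le_trans _ lo')// mulr_ge0 ?subr_ge0//.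
  by rewrite ltW// F_pos// u_ge0.
apply/cvgrPdist_le => e e0; rewrite near_withinE; near=> s => /=.
rewrite in_itv/= => /andP[s0 sT].
have sr : s <= r by apply/ltW; near: s; exact: lt_nbhsl.
have ts : `|t - s| <= e / F (picard_lim F r).
  by near: s; apply: cvgr_dist_le => //; rewrite divr_gt0.
rewrite ler_pdivlMr// mulrC in ts; apply: le_trans ts.
have [st|/ltW ts] := leP s t.
  by rewrite [`|t - s|]ger0_norm ?subr_ge0// lip// ltW.
by rewrite distrC [`|t - s|]distrC [`|s - t|]ger0_norm ?subr_ge0// lip.
Unshelve. all: by end_near. Qed.

(** The difference quotient between [s] and [t] lies between [F (picard_lim F s)] and
    [F (picard_lim F t)], so it is at least as close to the latter as the former is; continuity of
    [F] and of the limit concludes. *)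
Lemma picard_lim_deriv (R : realType) (F : R -> R) (T t : R) :
  {within `[0, +oo[, continuous F} ->
  (forall x, 0 <= x -> 0 < F x) ->
  (forall x y, 0 <= x -> x <= y -> F x <= F y) ->
  travel_time F x @[x --> +oo] --> T -> 0 <= t -> t < T ->
  is_deriv_within `[0, T[ (picard_lim F) t (F (picard_lim F t)).
Proof.
move=> F_cont F_pos F_nd GT t0 tT.
have bnd := fun a b => picard_lim_bounds _ _ _ a b F_cont F_pos F_nd GT.
have u_ge0 := fun a => picard_lim_ge0 _ _ _ a F_pos F_nd GT.
have Fu_cvg : F (picard_lim F s) @[s --> within `[0, T[ (nbhs t)]
              --> F (picard_lim F t).
  have := (subspace_continuousP _ _).1 F_cont (picard_lim F t).
  rewrite /= in_itv/= andbT => /(_ (u_ge0 _ t0 tT)).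
  apply: cvg_trans => U /=; rewrite /within/= => FU.
  have H : \forall s \near t, `[0, T[%classic s -> `[0, +oo[%classic (picard_lim F s) ->
      U (F (picard_lim F s)).
    exact: picard_lim_cvg _ _ _ _ F_cont F_pos F_nd GT t0 tT _ FU.
  apply: filterS H => s /= H sD; apply: H => //.
  move: sD; rewrite !in_itv/= andbT => /andP[s0 sT]; exact: u_ge0.
apply/cvgrPdist_le => e e0.
move/cvgrPdist_le : Fu_cvg => /(_ _ e0).
rewrite !near_withinE. apply: filterS => s + sDt sD.
move=> /(_ sD); apply: le_trans.
move: sD; rewrite /= in_itv/= => /andP[s0 sT].
move: sDt; rewrite /= neq_lt => /orP[st|ts].
  have /andP[lo hi] := bnd _ _ s0 (ltW st) tT.
  (* For [s < t] both differences of the quotient are reversed to match the increment bounds. *)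
  rewrite -[(picard_lim F s - _) / _]mulrNN -invrN !opprB.
  rewrite -ler_pdivlMr ?subr_gt0// in lo.
  rewrite -ler_pdivrMr ?subr_gt0// in hi.
  by rewrite !ger0_norm; lra.
have /andP[lo hi] := bnd _ _ t0 (ltW ts) sT.
rewrite -ler_pdivlMr ?subr_gt0// in lo.
rewrite -ler_pdivrMr ?subr_gt0// in hi.
by rewrite !ler0_norm; lra.
Qed.

(** * Assembling the solution, and its blow-up at [T] *)

Theorem lemma2 (R : realType) (Df Dg : set R) (f gamma : R -> R) (T : R)
  (Df_sub : `[0, +oo[ `<=` Df)
  (Dg_sub : f @` `[0, +oo[ `<=` Dg)
  (f_cont : {within Df, continuous f})
  (f_incr : {in Df &, {homo f : x y / x <= y}})
  (gamma_cont : {within Dg, continuous gamma})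
  (gamma_incr : {in Dg &, {homo gamma : x y / x <= y}})
  (gf_cont : {within `[0, +oo[, continuous (fun w : R => gamma (f w))})
  (gf_pos : forall w : R, 0 <= w -> 0 < gamma (f w))
  (gf_incr : forall v w : R, 0 <= v -> v <= w -> gamma (f v) <= gamma (f w))
  (gf_lim : (\int[lebesgue_measure]_(s in `[0, w]) (gamma (f s))^-1)
              @[w --> +oo] --> T) :
  exists wp : R -> R,
    [/\ Cplus T wp,
        solves_cauchy (fun w : R => gamma (f w)) 0 T wp,
        {in `[0, T[ &, {homo wp : s t / s < t}},
        (forall t : R, t \in `[0, T[ ->
           picard (fun w : R => gamma (f w)) n t @[n --> \oo] --> wp t)
      & wp t @[t --> T^'-] --> +oo].

Proof.
pose F := fun w : R => gamma (f w); pose u := picard_lim F.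
have F_pos : forall x, 0 <= x -> 0 < F x := gf_pos.
have F_nd : forall x y, 0 <= x -> x <= y -> F x <= F y := gf_incr.
have GT : travel_time F x @[x --> +oo] --> T := gf_lim.
have bnd := fun a b => picard_lim_bounds _ _ _ a b gf_cont F_pos F_nd GT.
have u_ge0 := fun a => picard_lim_ge0 _ _ _ a F_pos F_nd GT.
have u0 : u 0 = 0.
  by rewrite /u /picard_lim; under eq_fun do rewrite picard_at0; exact: lim_cst.
have u_lt a b : 0 <= a -> a < b -> b < T -> u a < u b.
  move=> a0 ab bT; have /andP[+ _] := bnd _ _ a0 (ltW ab) bT.
  rewrite -subr_gt0; apply: lt_le_trans.
  by rewrite mulr_gt0 ?subr_gt0// F_pos// u_ge0// (lt_trans ab).
have u_le a b : 0 <= a -> a <= b -> b < T -> u a <= u b.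
  by move=> a0; rewrite le_eqVlt => /predU1P[->//|ab bT]; exact/ltW/u_lt.
exists u; split.
- split; last by move=> t; rewrite in_itv/= => /andP[t0 tT]; exact: u_ge0.
  apply/subspace_continuousP => t /=; rewrite in_itv/= => /andP[t0 tT].
  exact: picard_lim_cvg.
- split=> // t; rewrite in_itv/= => /andP[t0 tT].
  exact: picard_lim_deriv.
- move=> s t; rewrite !in_itv/= => /andP[s0 _] /andP[_ tT] st.
  exact: u_lt.
- move=> t; rewrite in_itv/= => /andP[t0 tT].
  by have [_] := picard_cvg _ _ _ _ F_pos F_nd GT t0 tT.
(* The threshold is raised to a nonnegative [M], where the travel time is known to be below [T]. *)
- apply/cvgryPgt => A; pose M := Num.max 0 A.
  have M0 : 0 <= M by rewrite le_max lexx.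
  have GM : travel_time F M < T by exact: travel_time_lt_lim.
  have GM0 : 0 <= travel_time F M.
    apply: Rintegral_ge0 => s /=; rewrite in_itv/= => /andP[s0 _].
    by rewrite invr_ge0 ltW// F_pos.
  (* For [t] close to [T], [travel_time F M < t <= travel_time F (u t)]; as the travel time is
     strictly increasing, [u t] exceeds [M]. *)
  near=> t.
  have Gt : travel_time F M < t by near: t; exact: nbhs_left_gt.
  have tT : t < T by near: t; exact: nbhs_left_lt.
  have t0 : 0 <= t by rewrite (le_trans GM0)// ltW.
  apply: (@le_lt_trans _ _ M); first by rewrite le_max lexx orbT.
  have tG : t <= travel_time F (u t).
    apply: travel_time_ge => // a b a0 ab bt; have bT := le_lt_trans bt tT.
      exact: u_le.
    by have /andP[] := bnd _ _ a0 ab bT.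
  rewrite ltNge; apply/negP; rewrite le_eqVlt => /predU1P[uM|uM].
    by move: tG; rewrite uM leNgt Gt.
  have := travel_time_lt _ _ _ _ F_pos F_nd (u_ge0 _ t0 tT) uM.
  by rewrite ltNge (le_trans _ tG)// ltW.
Unshelve. all: by end_near. Qed.
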